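(* Let $k\ge 2$. The correspondence $F(\alpha)\mapsto A(\alpha)$, assigning to each $n$-nest ($\alpha$ ranging over all $k$-germs) its signature, is a bijection from the set of $n$-nests onto the set of their signatures; in particular, distinct $n$-nests have distinct signatures, and $F(\alpha)$ is determined by $A(\alpha)$.
   Context: A $k$-germ ($k\ge 2$) is a string $\alpha=a_{k-1}a_{k-2}\cdots a_1$ of nonnegative integers with $a_{k-1}\in\{0,1\}$ and $0\le a_{i-1}\le a_i+1$ for $1<i<k$. For $\alpha\neq 0^{k-1}$ let $i(\alpha)$ be the index of the rightmost nonzero entry of $\alpha$, and let the parent $\beta$ of $\alpha$ be the $k$-germ equal to $\alpha$ except that $b_{i(\alpha)}=a_{i(\alpha)}-1$; this makes the $k$-germs the nodes of a tree $\mathcal T_k$ rooted at $0^{k-1}$. The $n$-nest $F(\alpha)$ ($n=2k+1$) is defined recursively along $\mathcal T_k$: $F(0^{k-1})=0\,1\,2\cdots(k-1)\,k\,k\,(k-1)\cdots 2\,1$; for $\alpha\ne 0^{k-1}$ with parent $\beta$ and $i=i(\alpha)$, write $F(\beta)=W^i|M|Z^i$ where $W^i$, $Z^i$ are the leftmost and rightmost substrings of length $i$, let $c$ be the leftmost entry of $M$, and split $M=X|Y$ where $Y$ starts at the (leftmost) entry equal to $c+1$ in $M$; then $F(\alpha)=W^i|Y|X|Z^i$. Each $j\in[1,k]$ appears exactly twice in $F(\alpha)$, at positions $p_j<q_j$. The signature of $\alpha$ is $A(\alpha)=(A_{k-1}(\alpha),\dots,A_1(\alpha))$ with $A_j(\alpha)=\lfloor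 (q_j-p_j)/2\rfloor$ (equivalently, the number of integers both of whose appearances lie strictly between the two appearances of $j$ in $F(\alpha)$). *)

(* Defs.v *)
From mathcomp Require Import all_boot.
From mathcomp Require Import zify.
From mathcomp Require Import classical_sets functions.

Set Implicit Arguments.
Unset Strict Implicit.
Unset Printing Implicit Defensive.

Local Open Scope nat_scope.

(* A string a_{k-1} ... a_1 is the sequence [:: a_{k-1}; ...; a_1]: entries are
   indexed from right to left, starting at 1. *)
Definition entry (a : seq nat) (i : nat) : nat := nth 0 a (size a - i).

Definition is_germ (k : nat) (a : seq nat) : Prop :=
  [/\ size a = k.-1,
      entry a k.-1 \in [:: 0; 1]
    & forall i, 1 < i < k -> entry a i.-1 <= (entry a i).+1].

Definition root_germ (k : nat) : seq nat := nseq k.-1 0.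

(* i(a), meaningful when some entry of a is nonzero *)
Definition last_nz (a : seq nat) : nat := (find (fun x => x != 0) (rev a)).+1.

Definition parent (a : seq nat) : seq nat :=
  set_nth 0 a (size a - last_nz a) (entry a (last_nz a)).-1.

Definition root_nest (k : nat) : seq nat := iota 0 k.+1 ++ rev (iota 1 k).

(* W|M|Z |-> W|Y|X|Z with M = X|Y, where W and Z have length i *)
Definition swap_blocks (i : nat) (s : seq nat) : seq nat :=
  let W := take i s in
  let M := take (size s - i.*2) (drop i s) in
  let Z := drop (size s - i) s in
  let c := head 0 M in
  let X := take (index c.+1 M) M in
  let Y := drop (index c.+1 M) M in
  W ++ Y ++ X ++ Z.

(* The recursion along the tree; each step to the parent lowers the sum of the
   entries by 1, so the sum bounds the depth.  The two recursion equations are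
   nest_root and nest_parent below. *)
Fixpoint nest_rec (d k : nat) (a : seq nat) : seq nat :=
  if d is d'.+1 then
    if a == root_germ k then root_nest k
    else swap_blocks (last_nz a) (nest_rec d' k (parent a))
  else root_nest k.

Definition nest (k : nat) (a : seq nat) : seq nat := nest_rec (sumn a) k a.

(* When j occurs exactly twice in s, its positions p_j < q_j are first_pos j s
   and last_pos j s (counted from 0). *)
Definition first_pos (j : nat) (s : seq nat) : nat := index j s.
Definition last_pos (j : nat) (s : seq nat) : nat :=
  (size s).-1 - index j (rev s).

Definition nest_signature (k : nat) (s : seq nat) : seq nat :=
  [seq (last_pos j s - first_pos j s)./2 | j <- rev (iota 1 k.-1)].

Definition signature (k : nat) (a : seq nat) : seq nat :=
  nest_signature k (nest k a).

Definition germs (k : nat) : set (seq nat) := [set a | is_germ k a]%classic.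
Definition nests (k : nat) : set (seq nat) := (nest k @` germs k)%classic.
Definition signatures (k : nat) : set (seq nat) :=
  (signature k @` germs k)%classic.

Lemma nest_root (k : nat) : nest k (root_germ k) = root_nest k.
Proof. by rewrite /nest; case: (sumn _) => //= d; rewrite eqxx. Qed.

Lemma has_nz (k : nat) (a : seq nat) :
  size a = k.-1 -> a != root_germ k -> has (fun x => x != 0) a.
Proof.
move=> sa; apply: contraR => /hasPn a0.
rewrite /root_germ -sa; apply/eqP/all_pred1P.
by apply/allP => x /a0; rewrite negbK.
Qed.

Lemma sumn_parent (a : seq nat) :
  has (fun x => x != 0) a -> sumn a = (sumn (parent a)).+1.
Proof.
rewrite -has_rev => ha; rewrite /parent /entry /last_nz.
set f := find _ _; have lf : f < size a by rewrite -size_rev -has_find.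
have := nth_find 0 ha; rewrite nth_rev // -/f.
move: (_ - f.+1) => i nz.
have le : nth 0 a i <= sumn a.
  clear; elim: a i => [|x s IH] [|i] //=; first exact: leq_addr.
  exact: leq_trans (IH i) (leq_addl _ _).
rewrite sumn_set_nth0; case: (nth 0 a i) nz le => // m _ le.
by rewrite /=; lia.
Qed.

Lemma nest_parent (k : nat) (a : seq nat) :
  size a = k.-1 -> a != root_germ k ->
  nest k a = swap_blocks (last_nz a) (nest k (parent a)).
Proof.
move=> sa nr; rewrite /nest (sumn_parent (has_nz sa nr)) /=.
by rewrite (negbTE nr).
Qed.

(* Main.v *)
(* An n-nest minus its leading 0 is the contour word of an ordered tree with
   edges labelled 1..k in breadth-first order, right to left.  With the
   conventions a_0 = a_k = 0, the children of j in the tree of the germ a are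
   the labels from j + 1 + a_j up to j + 1 + a_{j+1}.  The swap that produces
   the nest of a from that of its parent moves the rightmost child of i = i(a)
   to become the leftmost child of i - 1, which leaves the breadth-first order
   unchanged.  The signature entry A_j is the number of descendants of j, and
   the numbers of descendants, listed in breadth-first order, determine how
   many children each node has, hence the tree and the nest. *)
Require Import Defs.
From mathcomp Require Import all_boot.
From mathcomp Require Import zify.
From mathcomp Require Import classical_sets functions.

Set Implicit Arguments.
Unset Strict Implicit.
Unset Printing Implicit Defensive.

Local Open Scope nat_scope.

(** * Contour words of trees labelled in breadth-first order *)

(* Encodes an ordered tree on 0..k labelled in breadth-first order: the children
   of j are the labels in [g j, g j.+1). *)
Definition bfs_cuts (k : nat) (g : nat -> nat) : Prop :=
  [/\ g 0 = 1, {homo g : i j / i <= j}, forall j, j <= k -> j < g j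
    & forall j, k <= j -> g j = k.+1].

Definition children (g : nat -> nat) (j : nat) : seq nat :=
  rev (index_iota (g j) (g j.+1)).

Fixpoint word_rec (g : nat -> nat) (n j : nat) : seq nat :=
  if n is n'.+1 then
    flatten [seq m :: rcons (word_rec g n' m) m | m <- children g j]
  else [::].

Definition word (k : nat) (g : nat -> nat) (j : nat) : seq nat :=
  word_rec g (k - j) j.

Definition block (k : nat) (g : nat -> nat) (m : nat) : seq nat :=
  m :: rcons (word k g m) m.

Definition forest (k : nat) (g : nat -> nat) (s : seq nat) : seq nat :=
  flatten [seq block k g m | m <- s].

Lemma children_bounds k g j m :
  bfs_cuts k g -> m \in children g j -> [/\ j < k, j < m, g j <= m & m <= k].
Proof.
move=> [g0 gm gj gk]; rewrite mem_rev mem_index_iota => /andP[lm mu].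
have jk : j < k by rewrite ltnNge; apply/negP => kj; move: mu lm; rewrite !gk; lia.
have := gm j.+1 k jk; rewrite (gk k) // => ?.
have := gj j (ltnW jk); split=> //; lia.
Qed.

Lemma children_nil k g j : bfs_cuts k g -> k <= j -> children g j = [::].
Proof. by move=> [_ _ _ gk] kj; rewrite /children !gk ?leqW // /index_iota subnn. Qed.

(** Labels increase from parent to child and never exceed [k], so [k - j] levels reach every
    descendant of [j]. *)
Lemma word_rec_fuel k g n j :
  bfs_cuts k g -> k - j <= n -> word_rec g n j = word k g j.
Proof.
move=> cg; have [N] := ubnP n; elim: N n j => // N IH n j nN jn.
rewrite /word; have [kj|jk] := leqP k j.
  have -> : k - j = 0 by lia.
  by case: n {nN jn} => //= n; rewrite (children_nil cg kj).
case: n nN jn => [|n] nN jn; first lia.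
case E: (k - j) => [|d] /=; first lia.
congr flatten; apply/eq_in_map => m /(children_bounds cg)[_ jm _ mk].
by rewrite (IH n) ?(IH d) //; lia.
Qed.

Lemma wordE k g j : bfs_cuts k g -> word k g j = forest k g (children g j).
Proof.
move=> cg; rewrite -(@word_rec_fuel k g (k - j).+1 j cg) //=.
congr flatten; apply/eq_in_map => m /(children_bounds cg)[_ jm _ mk].
by rewrite (word_rec_fuel cg) //; lia.
Qed.

Lemma forest_cat k g s t : forest k g (s ++ t) = forest k g s ++ forest k g t.
Proof. by rewrite /forest map_cat flatten_cat. Qed.

Lemma forest_cons k g m s : forest k g (m :: s) = block k g m ++ forest k g s.
Proof. by []. Qed.

Lemma forest_rcons k g s m : forest k g (rcons s m) = forest k g s ++ block k g m.
Proof. by rewrite -cats1 forest_cat /forest /= cats0. Qed.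

(** The subtree of [j] consults the cuts only at [j] and at larger labels. This lets the swap change
    one cut without touching the later subtrees. *)
Lemma eq_word k g h j : bfs_cuts k g -> bfs_cuts k h ->
  (forall x, j <= x -> g x = h x) -> word k g j = word k h j.
Proof.
move=> cg ch; have [n] := ubnP (k - j); elim: n j => // n IH j kj gh.
rewrite !wordE // /children !gh // -/(children h j).
congr flatten; apply/eq_in_map => m /(children_bounds ch)[jk jm _ mk].
by rewrite /block IH //; [lia | move=> x mx; apply: gh; lia].
Qed.

Lemma eq_forest k g h i s : bfs_cuts k g -> bfs_cuts k h ->
  (forall x, i <= x -> g x = h x) -> (forall m, m \in s -> i <= m) ->
  forest k g s = forest k h s.
Proof.
move=> cg ch gh si; congr flatten; apply/eq_in_map => m /si im.
by rewrite /block (eq_word cg ch) // => x mx; apply: gh; lia.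
Qed.

Lemma mem_word k g j x : bfs_cuts k g -> x \in word k g j -> g j <= x.
Proof.
move=> cg; have [n] := ubnP (k - j); elim: n j => // n IH j kj.
rewrite wordE // => /flattenP[_ /mapP[m /(children_bounds cg)[jk jm gjm mk] ->]].
rewrite in_cons mem_rcons in_cons orbA orbb => /orP[/eqP-> //|/IH xm].
have [_ gm _ _] := cg.
by apply: leq_trans (gm j m (ltnW jm)) (xm _); lia.
Qed.

Lemma mem_forest k g s x : bfs_cuts k g -> x \in forest k g s ->
  exists2 m, m \in s & x = m \/ g m <= x.
Proof.
move=> cg /flattenP[_ /mapP[m ms ->]] xm; exists m => //; move: xm.
rewrite in_cons mem_rcons in_cons orbA orbb => /orP[/eqP|/(mem_word cg)]; auto.
Qed.

Lemma rev_index_iota_recl m n :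
  m < n -> rev (index_iota m n) = rcons (rev (index_iota m.+1 n)) m.
Proof.
by move=> mn; rewrite -rev_cons /index_iota; congr rev; rewrite -(subnSK mn).
Qed.

Lemma rev_index_iota_recr m n :
  m <= n -> rev (index_iota m n.+1) = n :: rev (index_iota m n).
Proof.
move=> mn; rewrite /index_iota subSn // -addn1 iotaD rev_cat /=.
by rewrite subnKC.
Qed.

Lemma iota_recr m n : iota m n.+1 = rcons (iota m n) (m + n).
Proof. by rewrite -addn1 iotaD cats1. Qed.

(** * The block swap as a move of one subtree *)

(** The nodes below [i] form a path, and [i] is the last child of [i - 1]. Counting the closing [i]
    with the suffix gives both ends length [i], so they are the [W] and [Z] of [swap_blocks i]. *)
Lemma word_spine k g i : bfs_cuts k g -> i < k ->
  (forall x, x < i -> g x = x.+1) ->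
  0 :: word k g 0 = iota 0 i ++
    (forest k g (rev (index_iota i.+1 (g i))) ++ i :: word k g i) ++
    rev (iota 1 i).
Proof.
move=> cg; have [g0 gm gj gk] := cg.
elim: i => [|i IH] ik gi; first by rewrite g0 /= cats0.
rewrite IH; [|lia|by move=> x xi; apply: gi; lia].
rewrite !iota_recr rev_rcons add0n add1n {1}gi // {1}/index_iota subnn cat0s.
rewrite wordE // /children gi // rev_index_iota_recl; last by apply: gj; lia.
by rewrite forest_rcons /block -!cats1 -!catA /= -!catA /= -!catA.
Qed.

Lemma swap_blocks_cat i c W X Y Z :
  size W = i -> size Z = i -> X != [::] -> Y != [::] ->
  head 0 X = c -> head 0 Y = c.+1 -> c.+1 \notin X ->
  swap_blocks i (W ++ (X ++ Y) ++ Z) = W ++ Y ++ X ++ Z.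
Proof.
case: X => [//|x X]; case: Y => [//|y Y] /= sW sZ _ _ -> -> cX.
rewrite /swap_blocks take_size_cat //.
have -> : drop i (W ++ c :: (X ++ c.+1 :: Y) ++ Z) = (c :: (X ++ c.+1 :: Y)) ++ Z.
  by rewrite drop_size_cat.
have -> : size (W ++ c :: (X ++ c.+1 :: Y) ++ Z) - i.*2 = size (c :: (X ++ c.+1 :: Y)).
  by rewrite /= !size_cat /= !size_cat /=; lia.
have -> : drop (size (W ++ c :: (X ++ c.+1 :: Y) ++ Z) - i)
    (W ++ c :: (X ++ c.+1 :: Y) ++ Z) = Z.
  rewrite -cat_cons catA drop_size_cat // !size_cat /= !size_cat /=; lia.
rewrite take_size_cat // [head _ _]/=.
have -> : index c.+1 (c :: X ++ c.+1 :: Y) = size (c :: X).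
  by rewrite -cat_cons index_cat (negbTE cX) /= eqxx addn0.
by rewrite -!cat_cons take_size_cat // drop_size_cat.
Qed.

(* In the tree of h, [h i] is the rightmost child of i; in that of g it is the
   leftmost child of i - 1. *)
Lemma swap_blocks_word k g h i : bfs_cuts k g -> bfs_cuts k h ->
  0 < i < k -> (forall x, x < i -> g x = x.+1) ->
  (forall x, x != i -> h x = g x) -> g i = (h i).+1 ->
  swap_blocks i (0 :: word k h 0) = 0 :: word k g 0.
Proof.
move=> cg ch /andP[i0 ik] gx hg gi.
have hx x : x < i -> h x = x.+1 by move=> xi; rewrite hg ?gx //; lia.
have [_ gm gj gk] := cg; have [_ hm hj hk] := ch.
rewrite (word_spine cg ik gx) (word_spine ch ik hx) !wordE // /children.
have hi1 : h i.+1 = g i.+1 by rewrite hg //; lia.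
have gh x : i.+1 <= x -> g x = h x by move=> xi; rewrite hg //; lia.
have gii := gm i i.+1 (leqnSn i).
have hii := hj i (ltnW ik).
rewrite hi1 (rev_index_iota_recl (m := h i)); last lia.
rewrite -gi forest_rcons.
have -> : rev (index_iota i.+1 (g i)) = h i :: rev (index_iota i.+1 (h i)).
  by rewrite gi rev_index_iota_recr.
have fE s : (forall m, m \in s -> i.+1 <= m) -> forest k g s = forest k h s.
  by apply: eq_forest.
rewrite !fE; first last.
- by move=> m; rewrite in_cons mem_rev mem_index_iota; lia.
- by move=> m; rewrite mem_rev mem_index_iota; lia.
rewrite -cat_cons [_ ++ _ ++ block _ _ _]catA.
(* [M] opens with the leftmost child of [i - 1], labelled [h i - 1] (this is [i] itself for an only
   child). Hence [c.+1] is [h i], the rightmost child of [i], and [Y] is its block. *)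
rewrite (@swap_blocks_cat i (h i).-1) ?size_rev ?size_iota //.
- by rewrite forest_cons -!catA.
- by case: (forest _ _ _).
- have [->|ne] := eqVneq (h i) i.+1; first by rewrite /index_iota subnn.
  by rewrite -(ltn_predK hii) rev_index_iota_recr //=; lia.
- by rewrite /= (ltn_predK hii).
rewrite (ltn_predK hii) mem_cat in_cons !negb_or; apply/and3P; split.
(* A node [m] here lies below [h i], while its descendants are at least [h i.+1], which equals
   [g i.+1] and so exceeds [h i]. *)
- apply/negP => /(mem_forest ch)[m]; rewrite mem_rev mem_index_iota => mi.
  by have := hm i.+1 m; lia.
- by lia.
- apply/negP => /(mem_forest ch)[m]; rewrite mem_rev mem_index_iota => mi.
  by have := hj m; have := gm i.+1 k ik; have := gk k; lia.
Qed.

(** * The tree of a germ *)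

(* [entry a k] is the junk value a_{k-1}, not 0, hence the case distinction. *)
Definition germ_cuts (k : nat) (a : seq nat) (j : nat) : nat :=
  if j < k then (j + entry a j).+1 else k.+1.

Lemma entry0 a : entry a 0 = 0.
Proof. by rewrite /entry subn0 nth_default. Qed.

(** Monotonicity of the cuts is the germ inequality between neighbouring entries; at the upper end
    it is the bound on the leading entry. *)
Lemma germ_cutsP k a : 0 < k -> is_germ k a -> bfs_cuts k (germ_cuts k a).
Proof.
move=> k0 [sa a1 aj]; rewrite /germ_cuts; split.
- by rewrite k0 entry0.
- apply: homo_leq => [//|y x z|j]; first exact: leq_trans.
  case: (ltnP j k) => jk; last by case: ifP; lia.
  case: (ltnP j.+1 k) => jk'.
    have [->|j0] := posnP j; first by rewrite entry0; lia.
    by have := aj j.+1; rewrite /=; lia.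
  have -> : j = k.-1 by lia.
  by move: a1; rewrite !inE; lia.
- by move=> j jk; case: ifP; lia.
- by move=> j; case: ifP; lia.
Qed.

Lemma last_nzP k a : size a = k.-1 -> a != root_germ k ->
  [/\ 0 < last_nz a < k, entry a (last_nz a) != 0
    & forall x, x < last_nz a -> entry a x = 0].
Proof.
move=> sa nr; have ha := has_nz sa nr; rewrite -has_rev in ha.
have fs := ha; rewrite has_find size_rev in fs.
rewrite /last_nz; split; first by rewrite -ltn_predRL -sa.
  by have := nth_find 0 ha; rewrite nth_rev.
case=> [|x] xi; first exact: entry0.
have /negbFE/eqP := @before_find _ 0 (fun x => x != 0) (rev a) x xi.
by rewrite nth_rev //; apply: leq_trans (ltnW fs).
Qed.

Lemma size_parent k a :
  size a = k.-1 -> a != root_germ k -> size (parent a) = k.-1.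
Proof.
move=> sa nr; have [ik _ _] := last_nzP sa nr.
by rewrite /parent size_set_nth sa; apply/maxn_idPr; lia.
Qed.

Lemma entry_parent k a x : size a = k.-1 -> a != root_germ k -> x < k ->
  entry (parent a) x = if x == last_nz a then (entry a x).-1 else entry a x.
Proof.
move=> sa nr xk; have [ik _ _] := last_nzP sa nr.
rewrite {1}/entry (size_parent sa nr) /parent nth_set_nth /= sa.
have -> : (k.-1 - x == k.-1 - last_nz a) = (x == last_nz a) by lia.
by rewrite /entry sa; case: eqP => [->|].
Qed.

Lemma parent_germ k a : is_germ k a -> a != root_germ k -> is_germ k (parent a).
Proof.
move=> [sa a1 aj] nr; have [ik anz a0] := last_nzP sa nr.
split.
- exact: size_parent.
- rewrite (entry_parent sa nr); last lia.
  by case: ifP => // _; move: a1; rewrite !inE; lia.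
move=> i ki; have := aj i ki; rewrite !(entry_parent sa nr); try lia.
case: (eqVneq i (last_nz a)) => [->|_]; last by case: ifP; lia.
by rewrite a0; [case: ifP | lia].
Qed.

(** Induction on the sum of the entries. Passing to the parent lowers a single cut by one, at
    [last_nz a], and the zeros to its right make the earlier nodes a path, as [swap_blocks_word]
    requires. *)
Lemma nest_word k a : 0 < k -> is_germ k a ->
  nest k a = 0 :: word k (germ_cuts k a) 0.
Proof.
move=> k0; have [n] := ubnP (sumn a); elim: n a => // n IH a an ga.
have [sa a1 aj] := ga; have cg := germ_cutsP k0 ga.
have [ar|nr] := eqVneq a (root_germ k).
  have g x : x < k -> germ_cuts k a x = x.+1.
    by move=> xk; rewrite /germ_cuts xk /entry ar nth_nseq if_same addn0.
  (* The root germ gives a path. [word_spine] stops short of [k], so the innermost pair [k k] is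
     computed by hand. *)
  have k1 : k.-1 < k by lia.
  rewrite ar nest_root -ar (word_spine cg k1); last by move=> x xk; apply: g; lia.
  rewrite wordE // /children g // prednK //.
  have gk : germ_cuts k a k = k.+1 by rewrite /germ_cuts ltnn.
  have kE := prednK k0.
  have iotaE m : iota m k = rcons (iota m k.-1) (m + k.-1) by rewrite -{1}kE iota_recr.
  rewrite gk /index_iota subnn subSnn /root_nest iota_recr !iotaE rev_rcons.
  by rewrite add0n add1n kE /= /forest /= /block /word subnn /= -!cats1 -!catA.
have [ik anz a0] := last_nzP sa nr; have gp := parent_germ ga nr.
rewrite nest_parent // IH //; last first.
  by have := sumn_parent (has_nz sa nr); lia.
apply: swap_blocks_word => //; first exact: germ_cutsP.
- by move=> x xi; rewrite /germ_cuts a0 //; case: ifP; lia.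
- move=> x xi; rewrite /germ_cuts; case: ifP => // xk.
  by rewrite (entry_parent sa nr) // (negbTE xi).
- rewrite /germ_cuts; case: ifP => // xk; last by lia.
  by rewrite (entry_parent sa nr) // eqxx; lia.
Qed.

(** * Signature entries as subtree sizes *)

Lemma count_forest_range (k : nat) (g : nat -> nat) (p : pred nat) (m n : nat) :
  count p (forest k g (rev (index_iota m n))) =
  \sum_(m <= x < n) ((p x).*2 + count p (word k g x)).
Proof.
rewrite /forest count_flatten sumnE !big_map big_rev /=.
apply: eq_bigr => x _; rewrite /block /= -cats1 count_cat /=; lia.
Qed.

(* [x, g x) is the content of the breadth-first queue when x is dequeued. *)
Lemma count_word0 k g p : bfs_cuts k g ->
  count p (word k g 0) = (count p (iota 1 k)).*2.
Proof.
move=> cg; have [g0 gm gj gk] := cg.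
pose S x := count p (forest k g (rev (index_iota x (g x)))).
have Sstep x : 0 < x <= k -> S x = (p x).*2 + S x.+1.
  move=> xk; have := gj x; have := gm x x.+1 => h1 h2.
  rewrite /S !count_forest_range big_ltn; last lia.
  rewrite (@big_cat_nat _ _ _ (g x) _ (g x.+1)) /=; try lia.
  rewrite -addnA; congr addn; rewrite addnC; congr addn.
  by rewrite wordE // /children count_forest_range.
have Sk : S k.+1 = 0 by rewrite /S gk // /index_iota subnn.
have -> : count p (word k g 0) = S 1 by rewrite wordE // /children g0.
have S_iota n x : 0 < x -> x + n = k.+1 -> S x = (count p (iota x n)).*2.
  elim: n x => [|n IH] x x0 xn; first by move: xn; rewrite addn0 => ->.
  by rewrite Sstep ?(IH x.+1) //=; lia.
exact: S_iota.
Qed.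

Lemma bfs_parent k g j : bfs_cuts k g -> 0 < j <= k ->
  exists2 m, m < j & j \in children g m.
Proof.
move=> [g0 gm gj gk] /andP[j0 jk].
have ex : exists m, j < g m by exists j; apply: gj.
(* The parent of [j] is the predecessor of the least argument at which [g] exceeds [j]. *)
case: (ex_minnP ex) => [[|m] jm mmin]; first by rewrite g0 in jm; lia.
exists m; first by apply: mmin; apply: gj.
rewrite mem_rev mem_index_iota jm andbT leqNgt; apply/negP => /mmin; lia.
Qed.

Lemma infix_block k g j : bfs_cuts k g -> 0 < j <= k ->
  infix (block k g j) (word k g 0).
Proof.
move=> cg; elim/ltn_ind: j => j IH jk; have [m mj jm] := bfs_parent cg jk.
have ij : infix (block k g j) (word k g m).
  rewrite wordE //; case/splitPr: jm => s t.
  by rewrite forest_cat forest_cons infix_infix.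
have [m0|m0] := posnP m; first by rewrite m0 in ij.
apply: infix_trans ij (infix_trans _ (IH m mj _)); last lia.
exact: infix_trans (infix_rcons _ _) (infix_cons _ _).
Qed.

Lemma word_size_even k g j : bfs_cuts k g -> ~~ odd (size (word k g j)).
Proof.
move=> cg; have [n] := ubnP (k - j); elim: n j => // n IH j kj.
rewrite wordE // /forest size_flatten sumnE /shape !big_map.
rewrite big_seq; apply: (big_ind (fun x => ~~ odd x)) => //.
  by move=> x y; rewrite oddD => /negbTE-> /negbTE->.
move=> m /(children_bounds cg)[jk jm _ mk].
by rewrite /= size_rcons /= negbK IH //; lia.
Qed.

(** The block of [j] holds both copies of [j], at its two ends. Their distance is the even length of
    the enclosed word plus one, and halving drops that one. *)
Lemma signature_entry k g j : bfs_cuts k g -> 0 < j <= k ->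
  (last_pos j (0 :: word k g 0) - first_pos j (0 :: word k g 0))./2 =
  (size (word k g j))./2.
Proof.
move=> cg jk; have /infixP[U [V E]] := infix_block cg jk.
have [cU cV] : count_mem j U = 0 /\ count_mem j V = 0.
  (* The whole word has exactly two copies of [j], so the block leaves none for [U] and [V]. *)
  have := count_word0 (pred1 j) cg.
  rewrite (count_uniq_mem _ (iota_uniq _ _)) mem_iota add1n ltnS jk E.
  rewrite !count_cat /= -cats1 count_cat /= eqxx.
  by move: (count_mem j U) (count_mem j V) (count_mem j _) => u v w; lia.
have jU : j \notin 0 :: U.
  by rewrite in_cons negb_or (introT count_memPn cU) andbT; lia.
have jV : j \notin rev V by rewrite mem_rev; apply/count_memPn.
have revE : rev ((0 :: U) ++ block k g j ++ V) =
    rev V ++ j :: rev ((0 :: U) ++ j :: word k g j).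
  by rewrite /block -cats1 -cat_cons !catA rev_cat -!catA catA rev_cat.
rewrite E /first_pos /last_pos -cat_cons revE !index_cat (negbTE jU) (negbTE jV) /=.
rewrite eqxx mem_head size_rev !size_cat /= size_cat size_rcons; have := word_size_even j cg.
by move: (size (word k g j)) => x; lia.
Qed.

(** * Recovering the tree from its subtree sizes *)

Lemma sum_nat_upper_inj f m n n' : (forall x, 0 < f x) -> m <= n -> m <= n' ->
  \sum_(m <= x < n) f x = \sum_(m <= x < n') f x -> n = n'.
Proof.
move=> f0; wlog nn' : n n' / n <= n'.
  by move=> W mn mn' E; case/orP: (leq_total n n') => ?; [|symmetry]; apply: W.
move=> mn mn'; rewrite (@big_cat_nat _ _ _ n _ n') //=.
case: ltngtP nn' => // nn' _; rewrite [in X in _ + X]big_ltn //.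
by have := f0 n; lia.
Qed.

(** Once [g j] is known, the word of [j] has the total length of the consecutive blocks from [g j]
    up to [g j.+1]. Block lengths are positive, so this total fixes [g j.+1]. *)
Lemma sizes_eq_cuts k g h : bfs_cuts k g -> bfs_cuts k h ->
  (forall j, 0 < j < k -> size (word k g j) = size (word k h j)) -> g =1 h.
Proof.
move=> cg ch sgh.
have sE j : size (word k g j) = size (word k h j).
  (* Outside the range of the signature the sizes are forced: [2k] at the root, and [0] from [k]
     on. *)
  have [->|j0] := posnP j; first by rewrite -!count_predT !count_word0.
  have [jk|kj] := ltnP j k; first by apply: sgh; rewrite j0.
  by rewrite /word; have -> : k - j = 0 by lia.
elim=> [|j IH]; first by case: cg ch => -> _ _ _ [-> _ _ _].
have [_ gm _ _] := cg; have [_ hm _ _] := ch.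
have := sE j; rewrite -!count_predT !wordE // /children !count_forest_range -IH.
under [X in _ = X -> _]eq_bigr do rewrite count_predT -sE -count_predT.
by apply: sum_nat_upper_inj => //; [exact: gm | rewrite IH; exact: hm].
Qed.

Lemma nest_signature_inj k a b : 0 < k -> is_germ k a -> is_germ k b ->
  nest_signature k (nest k a) = nest_signature k (nest k b) ->
  nest k a = nest k b.
Proof.
move=> k0 ga gb; have ca := germ_cutsP k0 ga; have cb := germ_cutsP k0 gb.
rewrite !nest_word // => /eq_in_map sE.
have gE : germ_cuts k a =1 germ_cuts k b.
  apply: (sizes_eq_cuts ca cb) => j jk.
  have jk' : 0 < j <= k by lia.
  have := sE j; rewrite mem_rev mem_iota !signature_entry // => /(_ _) sj.
  have := word_size_even j ca; have := word_size_even j cb.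
  by have := sj ltac:(lia); lia.
by congr cons; apply: eq_word.
Qed.

Theorem theorem7 (k : nat) (hk : 2 <= k) :
  [/\ set_bij (nests k) (signatures k) (nest_signature k),
      (forall s t : seq nat, nests k s -> nests k t -> s <> t ->
         nest_signature k s <> nest_signature k t)
    & exists G : seq nat -> seq nat,
        forall a : seq nat, is_germ k a -> nest k a = G (signature k a)].
Proof.
have inj (s t : seq nat) : nests k s -> nests k t ->
    nest_signature k s = nest_signature k t -> s = t.
  by move=> [a ga <-] [b gb <-]; apply: nest_signature_inj => //; lia.
split.
- split.
  + by move=> _ [a ga <-]; exists a.
  + by move=> s t /set_mem ns /set_mem nt; apply: inj.
  + by move=> _ [a ga <-]; exists (nest k a) => //; exists a.
- by move=> s t ns nt st /(inj _ _ ns nt).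
have [G GP] : exists G : seq nat -> seq nat,
    forall s, nests k s -> G (nest_signature k s) = s.
  exists ('pinv_(fun=> [::]) (nests k) (nest_signature k)).
  move=> s ns; apply: pinvKV; last exact/mem_set.
  by move=> u v /set_mem nu /set_mem nv; apply: inj.
by exists G => a ga; rewrite GP //; exists a.
Qed.
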